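(* (I) Let $K$ be a compact Hausdorff space. The following are equivalent. (1) $K$ is $\pi$ZD, i.e. every nonempty open subset of $K$ contains a nonempty clopen subset of $K$. (2) For each open $W \subseteq K$ there is a family $\mathcal{U} \subseteq \operatorname{clop}(K)$ with $\overline{\bigcup \mathcal{U}} = \overline{W}$. (3) For each cozero-set $C = \{x \in K \mid f(x) \neq 0\}$, $f \in C(K)$, there is a family $\mathcal{U} \subseteq \operatorname{clop}(K)$ with $\overline{\bigcup \mathcal{U}} = \overline{C}$. (II) Let $(A,u)$ be an archimedean vector lattice with distinguished weak order unit $u$, with Yosida space $YA$ and Yosida representation $A \leq D(YA)$. The following are equivalent. (1) $A$ has SMP (sufficiently many projections). (2) For each open $W \subseteq YA$ there is a family $\mathcal{U} \subseteq \lambda A$ with $\overline{\bigcup \mathcal{U}} = \overline{W}$. (3) For each $C = \{x \in YA \mid a(x) \neq 0\}$, $a \in A$, there is a family $\mathcal{U} \subseteq \lambda A$ with $\overline{\bigcup \mathcal{U}} = \overline{C}$.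
   Context: For a space $X$, $\operatorname{clop}(X)$ is the family of clopen (closed and open) subsets of $X$, and overline denotes closure. For compact Hausdorff $X$, $D(X)$ is the set of continuous $f : X \to \mathbb{R} \cup \{\pm\infty\}$ with $f^{-1}(\mathbb{R})$ dense in $X$; it is a lattice under pointwise order, closed under multiplication by real scalars, with addition only partially defined: $f+g=h$ in $D(X)$ means $h \in D(X)$ and $h(x)=f(x)+g(x)$ on the dense set where $f$ and $g$ are both finite. A weak order unit of a vector lattice $A$ is $u>0$ such that $|a|\wedge u = 0$ implies $a=0$. For $(A,u)$ an archimedean vector lattice with distinguished weak order unit, the Yosida space $YA$ is the compact Hausdorff space of all ideals $M$ of $A$ maximal with respect to $u \notin M$, with the hull-kernel topology. The Yosida representation is a vector lattice isomorphism $\eta$ of $A$ onto a subset $\eta(A) \subseteq D(YA)$ (with all sums of elements of $\eta(A)$ existing in $D(YA)$ and lying in $\eta(A)$) with $\eta(u)=1$ and such that $\eta(A)$ 0-1 separates disjoint closed sets of $YA$ (for disjoint closed $E,F$ some element is $0$ on $E$ and $1$ on $F$). One identifies $A$ with $\eta(A)$ and writes $A \leq D(YA)$. For $a \in A$ and $U \in \operatorname{clop}(YA)$, $a\chi(U) \in D(YA)$ is the function equal to $a$ on $U$ and $0$ off $U$. $\lambda A$ denotes the family of all $U \in \operatorname{clop}(YA)$ such that $a\chi(U) \in A$ for every $a \in A$. A band in $A$ is an ideal closed under existing suprema of subsets of its elements; a projection band is a band $B$ for which $A = B \oplus B'$ for some band $B' \subseteq A$. $A$ has sufficiently many projections (SMP)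 if each nonzero band contains a nonzero projection band. *)

(* Defs.v *)
From HB Require Import structures.
From mathcomp Require Import all_boot all_order all_algebra.
From mathcomp Require Import all_classical all_reals all_analysis.

Set Implicit Arguments.
Unset Strict Implicit.
Unset Printing Implicit Defensive.

Import Order.TTheory GRing.Theory Num.Theory.
Import numFieldTopology.Exports.

Local Open Scope classical_set_scope.
Local Open Scope ring_scope.

(** The order is the one of [porderZmodType]. [Order.Lattice] cannot be
    inherited from: Hierarchy Builder would require its join with
    [GRing.Zmodule] to sit below the existing [Num.RealDomain]. *)
HB.mixin Record POrderedLmodule_isVectorLattice (R : numDomainType) A
    of GRing.Lmodule R A & Num.POrderedZmodule A := {
  vjoin : A -> A -> A;
  vmeet : A -> A -> A;
  vjoin_le : forall x y z : A, (vjoin x y <= z) = (x <= z) && (y <= z);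
  le_vmeet : forall x y z : A, (z <= vmeet x y) = (z <= x) && (z <= y);
  vlat_leD2r : forall z x y : A, x <= y -> x + z <= y + z;
  vlat_scale_ge0 : forall (r : R) (x : A), 0 <= r -> 0 <= x -> 0 <= r *: x
}.

#[short(type="vectorLatticeType")]
HB.structure Definition VectorLattice (R : numDomainType) :=
  { A of GRing.Lmodule R A & Num.POrderedZmodule A
       & POrderedLmodule_isVectorLattice R A }.

Section VectorLatticeDefs.
Variables (R : numDomainType) (A : vectorLatticeType R).
Implicit Types (a b u : A) (I B C : set A).

Definition vabs a : A := vjoin a (- a).

Definition archimedean_vlattice : Prop :=
  forall a b, 0 <= a -> (forall n : nat, a *+ n <= b) -> a = 0.

Definition weak_order_unit u : Prop :=
  0 < u /\ forall a, vmeet (vabs a) u = 0 -> a = 0.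

Record vlattice_ideal I : Prop := {
  vlattice_ideal0 : I 0;
  vlattice_idealD : forall a b, I a -> I b -> I (a + b);
  vlattice_idealZ : forall (r : R) a, I a -> I (r *: a);
  vlattice_ideal_solid : forall a b, vabs a <= vabs b -> I b -> I a
}.

Definition band B : Prop :=
  vlattice_ideal B /\ forall S s, S `<=` B -> supremums S s -> B s.

Definition direct_sum B C : Prop :=
  (forall a, exists b c, [/\ B b, C c & a = b + c]) /\ B `&` C = [set 0].

Definition projection_band B : Prop :=
  band B /\ exists2 C, band C & direct_sum B C.

Definition SMP : Prop :=
  forall B, band B -> B <> [set 0] ->
  exists C, [/\ projection_band C, C <> [set 0] & C `<=` B].

End VectorLatticeDefs.

Arguments archimedean_vlattice {R} A.
Arguments SMP {R} A.

Record yosida (R : realType) (A : vectorLatticeType R) (u : A) := Yosida {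
  yosida_ideal :> set A;
  yosida_idealP : vlattice_ideal yosida_ideal;
  yosida_unitN : ~ yosida_ideal u;
  yosida_max : forall J : set A, vlattice_ideal J -> ~ J u ->
    yosida_ideal `<=` J -> J = yosida_ideal
}.

Section HullKernel.
Variables (R : realType) (A : vectorLatticeType R) (u : A).
Implicit Types (a b x y z : A) (M : yosida u).

HB.instance Definition _ := gen_eqMixin (yosida u).
HB.instance Definition _ := gen_choiceMixin (yosida u).

Definition yosida_hull (S : set A) : set (yosida u) :=
  [set M | S `<=` yosida_ideal M].

Definition hull_kernel_open : set_system (yosida u) :=
  [set W | exists S, W = ~` yosida_hull S].

Lemma vlat_leD x y z t : x <= y -> z <= t -> x + z <= y + t.
Proof.
move=> xy zt; apply: (le_trans (vlat_leD2r z _ _ xy)).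
by rewrite ![y + _]addrC; exact: vlat_leD2r.
Qed.

Lemma vlat_subr_ge0 x y : (0 <= y - x) = (x <= y).
Proof.
apply/idP/idP => [/(@vlat_leD2r _ _ x)|/(@vlat_leD2r _ _ (- x))].
  by rewrite add0r subrK.
by rewrite subrr.
Qed.

Lemma vlat_ler_scale (r : R) x y : 0 <= r -> x <= y -> r *: x <= r *: y.
Proof.
by move=> r0 xy; rewrite -vlat_subr_ge0 -scalerBr vlat_scale_ge0// vlat_subr_ge0.
Qed.

Lemma le_vabs x : x <= vabs x.
Proof. by have := lexx (vabs x); rewrite {1}/vabs vjoin_le => /andP[]. Qed.

Lemma leN_vabs x : - x <= vabs x.
Proof. by have := lexx (vabs x); rewrite {1}/vabs vjoin_le => /andP[]. Qed.

Lemma vabs_ge0 x : 0 <= vabs x.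
Proof.
have h : 0 <= (2 : R) *: vabs x.
  by rewrite scaler_nat mulr2n -(subrr x) vlat_leD ?le_vabs ?leN_vabs.
have : 0 <= (2^-1 : R) *: ((2 : R) *: vabs x).
  by rewrite vlat_scale_ge0// invr_ge0 ler0n.
by rewrite scalerA mulVf ?scale1r// pnatr_eq0.
Qed.

Lemma vabs_le x y : (vabs x <= y) = (x <= y) && (- x <= y).
Proof. exact: vjoin_le. Qed.

Lemma vabsN x : vabs (- x) = vabs x.
Proof.
have h z : vabs (- z) <= vabs z by rewrite vabs_le opprK le_vabs leN_vabs.
by apply: le_anti; rewrite h -{1}[x]opprK h.
Qed.

Lemma ge0_vabs x : 0 <= x -> vabs x = x.
Proof.
move=> x0; apply: le_anti; rewrite le_vabs andbT vabs_le lexx/=.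
by rewrite (le_trans _ x0)// -vlat_subr_ge0 sub0r opprK.
Qed.

Lemma vabsD x y : vabs (x + y) <= vabs x + vabs y.
Proof.
rewrite vabs_le vlat_leD ?le_vabs//=.
by rewrite opprD vlat_leD ?leN_vabs.
Qed.

Lemma vabsZ_le (r : R) x : vabs (r *: x) <= `|r| *: vabs x.
Proof.
wlog r0 : r x / 0 <= r.
  move=> h; have [/h//|/ltW r0] := leP 0 r.
  have := h (- r) x; rewrite scaleNr vabsN normrN; apply.
  by rewrite oppr_ge0.
rewrite ger0_norm// vabs_le vlat_ler_scale ?le_vabs//=.
by rewrite -scalerN vlat_ler_scale ?leN_vabs.
Qed.

Lemma ideal_vabs (I : set A) x : vlattice_ideal I -> I x -> I (vabs x).
Proof.
by move=> iI; apply: (vlattice_ideal_solid iI); rewrite (ge0_vabs (vabs_ge0 x)).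
Qed.

(* By maximality, the ideal generated by M and a contains u. *)
Lemma yosida_absorb M a : ~ yosida_ideal M a ->
  exists m, exists2 r : R, 0 < r &
    [/\ yosida_ideal M m, 0 <= m & vabs u <= m + r *: vabs a].
Proof.
move=> Ma; have iM := yosida_idealP M.
pose J := [set x | exists m, exists2 r : R, 0 < r &
    [/\ yosida_ideal M m, 0 <= m & vabs x <= m + r *: vabs a]].
apply: contrapT => Ju; apply: Ma.
have J0 x : yosida_ideal M x -> J x.
  move=> Mx; exists (vabs x), 1 => //; split; [exact: ideal_vabs|exact: vabs_ge0|].
  by rewrite -[leLHS]addr0 vlat_leD// vlat_scale_ge0// vabs_ge0.
suff iJ : vlattice_ideal J.
  rewrite -(yosida_max iJ Ju J0); exists 0, 1 => //.
  by split; [exact: vlattice_ideal0|rewrite lexx|rewrite add0r scale1r lexx].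
split.
- by apply: J0; apply: vlattice_ideal0.
- move=> x y [m [r r0 [Mm m0 xm]]] [n [s s0 [Mn n0 yn]]].
  exists (m + n), (r + s); first exact: addr_gt0.
  split; first exact: vlattice_idealD.
    by rewrite -[0]addr0 vlat_leD.
  by rewrite scalerDl addrACA (le_trans (vabsD _ _))// vlat_leD.
- move=> r x [m [s s0 [Mm m0 xm]]].
  have r1 : `|r| <= `|r| + 1 by rewrite lerDl.
  have r2 : 0 < `|r| + 1 by rewrite ltr_wpDl.
  exists ((`|r| + 1) *: m), ((`|r| + 1) * s); first exact: mulr_gt0.
  split; [exact: vlattice_idealZ|exact/vlat_scale_ge0/m0/ltW|].
  rewrite -scalerA -scalerDr (le_trans (vabsZ_le _ _))//.
  apply: (@le_trans _ _ ((`|r| + 1) *: vabs x)).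
    by rewrite scalerDl scale1r -[leLHS]addr0 vlat_leD ?vabs_ge0.
  exact/vlat_ler_scale/xm/ltW.
- move=> x y xy [m [r r0 [Mm m0 ym]]]; exists m, r => //; split => //.
  exact: le_trans ym.
Qed.

Lemma vmeet_vabs_ge0 a b : 0 <= vmeet (vabs a) (vabs b).
Proof. by rewrite le_vmeet !vabs_ge0. Qed.

Lemma yosida_prime M a b :
  yosida_ideal M (vmeet (vabs a) (vabs b)) <->
  yosida_ideal M a \/ yosida_ideal M b.
Proof.
have iM := yosida_idealP M.
have := lexx (vmeet (vabs a) (vabs b)); rewrite le_vmeet => /andP[la lb].
split; last first.
  by case => ?; [apply: (vlattice_ideal_solid iM) (_ : yosida_ideal M a)|
    apply: (vlattice_ideal_solid iM) (_ : yosida_ideal M b)];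
    rewrite // (ge0_vabs (vmeet_vabs_ge0 _ _)).
move=> Mab; apply: contrapT => /not_orP[].
move=> /yosida_absorb[m [r r0 [Mm m0 um]]] /yosida_absorb[n [s s0 [Mn n0 un]]].
apply: (@yosida_unitN _ _ _ M).
have rs0 : 0 < r + s by exact: addr_gt0.
have h c t p q : 0 < t -> t <= r + s -> 0 <= q ->
    vabs u <= p + t *: vabs c -> (r + s)^-1 *: (vabs u - (p + q)) <= vabs c.
  move=> t0 trs q0 up.
  rewrite -[leRHS]scale1r -(mulVf (lt0r_neq0 rs0)) -scalerA.
  apply: vlat_ler_scale; first by rewrite invr_ge0 ltW.
  have : vabs u <= (p + q) + (r + s) *: vabs c.
    apply: (le_trans up); rewrite -addrA vlat_leD//.
    rewrite -[leLHS]add0r vlat_leD// -vlat_subr_ge0 -scalerBl.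
    rewrite vlat_scale_ge0 ?vabs_ge0//.
    by rewrite subr_ge0.
  by move=> /(vlat_leD2r (- (p + q))); rewrite addrAC subrr add0r.
have hm : (r + s)^-1 *: (vabs u - (m + n)) <= vmeet (vabs a) (vabs b).
  rewrite le_vmeet; apply/andP; split.
    by apply: (h a r) => //; rewrite lerDl ltW.
  by rewrite [m + n]addrC; apply: (h b s) => //; rewrite lerDr ltW.
have {}hm : vabs u <= (m + n) + (r + s) *: vmeet (vabs a) (vabs b).
  have := vlat_ler_scale (ltW rs0) hm.
  rewrite scalerA divff ?scale1r ?lt0r_neq0// => /(vlat_leD2r (m + n)).
  by rewrite subrK addrC.
have Mw : yosida_ideal M ((m + n) + (r + s) *: vmeet (vabs a) (vabs b)).
  by apply: vlattice_idealD => //; [exact: vlattice_idealD|exact: vlattice_idealZ].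
apply: (vlattice_ideal_solid iM) Mw.
by rewrite (le_trans hm)// le_vabs.
Qed.

Lemma hull_kernel_openT : hull_kernel_open setT.
Proof.
exists [set u]; apply/esym; rewrite -subTset => M _ /(_ u erefl).
exact: yosida_unitN.
Qed.

Lemma yosida_hullNE S M :
  (~` yosida_hull S) M <-> exists2 a, S a & ~ yosida_ideal M a.
Proof.
split=> [/existsNP[a /not_implyP[Sa Ma]]|[a Sa Ma] /(_ a Sa)//].
by exists a.
Qed.

Lemma hull_kernel_openI : setI_closed hull_kernel_open.
Proof.
move=> _ _ [S ->] [T ->].
exists [set vmeet (vabs a) (vabs b) | a in S & b in T].
apply/seteqP; split => M.
  case=> /yosida_hullNE[a Sa Ma] /yosida_hullNE[b Tb Mb]; apply/yosida_hullNE.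
  exists (vmeet (vabs a) (vabs b)); first by exists a => //; exists b.
  by move=> /yosida_prime[].
move=> /yosida_hullNE[_ [a Sa [b Tb <-]]] /yosida_prime/not_orP[Ma Mb].
by split; apply/yosida_hullNE; [exists a|exists b].
Qed.

Lemma hull_kernel_open_bigU (I : Type) (f : I -> set (yosida u)) :
  (forall i, hull_kernel_open (f i)) -> hull_kernel_open (\bigcup_i f i).
Proof.
move=> /choice[S fS]; exists (\bigcup_i S i); apply/seteqP; split => M.
  case=> i _; rewrite fS => /yosida_hullNE[a Sa Ma]; apply/yosida_hullNE.
  by exists a => //; exists i.
move=> /yosida_hullNE[a [i _ Sa] Ma]; exists i => //.
rewrite fS; apply/yosida_hullNE; by exists a.
Qed.

HB.instance Definition _ := isOpenTopological.Build (yosida u)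
  hull_kernel_openT hull_kernel_openI hull_kernel_open_bigU.

End HullKernel.

Section ExtendedRealFunctions.
Variables (R : realType) (X : topologicalType).
Implicit Types f g h : X -> \bar R.

Definition Dspace : set (X -> \bar R) :=
  [set f | continuous f /\ dense [set x | f x \is a fin_num]].

(** [f + g = h] in [Dspace]. *)
Definition Dsum f g h : Prop :=
  Dspace h /\
  forall x, f x \is a fin_num -> g x \is a fin_num -> h x = (f x + g x)%E.

End ExtendedRealFunctions.

(** In [yosida_rep_scale], [0 * +oo = 0] in [\bar R], so that [eta (0 *: a)] is the
    zero function. *)
Record yosida_representation (R : realType) (A : vectorLatticeType R) (u : A)
    (eta : A -> yosida u -> \bar R) : Prop := {
  yosida_repD : forall a, Dspace (eta a);
  yosida_rep_inj : injective eta;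
  yosida_rep_add : forall a b, Dsum (eta a) (eta b) (eta (a + b));
  yosida_rep_scale : forall (r : R) a M, eta (r *: a) M = (r%:E * eta a M)%E;
  yosida_rep_join : forall a b M,
    eta (vjoin a b) M = Order.max (eta a M) (eta b M);
  yosida_rep_meet : forall a b M,
    eta (vmeet a b) M = Order.min (eta a M) (eta b M);
  yosida_rep_unit : eta u = cst 1%E;
  yosida_rep_separates : forall E F : set (yosida u),
    closed E -> closed F -> E `&` F = set0 ->
    exists a, (forall M, E M -> eta a M = 0%E) /\
              (forall M, F M -> eta a M = 1%E)
}.

Definition yosida_lambda (R : realType) (A : vectorLatticeType R) (u : A)
    (eta : A -> yosida u -> \bar R) : set (set (yosida u)) :=
  [set U | clopen U /\ forall a, range eta (patch (cst 0%E) U (eta a))].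

Definition piZD (X : topologicalType) : Prop :=
  forall W : set X, open W -> W !=set0 ->
  exists U, [/\ clopen U, U !=set0 & U `<=` W].

(** [W] has the same closure as the union of some subfamily of [F]. *)
Definition approximable (X : topologicalType) (F : set (set X)) (W : set X) :=
  exists2 UU : set (set X), UU `<=` F &
    closure (\bigcup_(U in UU) U) = closure W.

(* Main.v *)
(** A family of sets such that every nonempty open set contains a nonempty
    member approximates every open set, by all its members inside that set;
    conversely, approximating functions whose support sits in a given open set
    produces a nonempty member inside it.

    For the vector lattice, the elements vanishing on an open subset of the
    Yosida space form a band, and the projection bands are exactly the bands of
    elements vanishing off some [U] in [yosida_lambda eta].  A projection band
    inside the band attached to a small open set thus yields a small such [U].
    Conversely, if [b <> 0] lies in a band [B], a member [U] on which [|b|] is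
    bounded away from 0 gives a projection band inside [B]. *)
Require Import Defs.
From mathcomp Require Import all_boot all_order all_algebra.
From mathcomp Require Import all_classical all_reals all_analysis.

Set Implicit Arguments.
Unset Strict Implicit.
Unset Printing Implicit Defensive.

Import Order.TTheory GRing.Theory Num.Theory.
Import numFieldTopology.Exports.

Local Open Scope classical_set_scope.
Local Open Scope ring_scope.

(** * Approximation of open sets, and equality of continuous maps, up to density *)

Section Approximable.
Variable X : topologicalType.
Implicit Types (F : set (set X)) (W U : set X).

Lemma pi_base_approximable F :
  (forall W, open W -> W !=set0 ->
     exists U, [/\ F U, U !=set0 & U `<=` W]) ->
  forall W, open W -> approximable F W.
Proof.
move=> Fpi W oW; exists [set U | F U /\ U `<=` W]; first by move=> U [].
apply/seteqP; split; first by apply: closure_subset => x [U [_ UW] /UW].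
move=> x cWx V Vx.
have [y [Wy Vy]] := cWx _ (open_nbhs_nbhs (conj (open_interior V) Vx)).
have [||U [FU [z Uz] UWV]] := Fpi (W `&` V^°).
- exact/openI/open_interior.
- by exists y.
exists z; have [Wz Vz] := UWV z Uz; split; last exact: interior_subset.
by exists U => //; split=> // t /UWV[].
Qed.

(** Equality of closures only places members inside the closure of [W], so to land in a given open
    set one applies this to a [W] whose closure is still contained in it. *)
Lemma approximable_subclosure F W : approximable F W -> W !=set0 ->
  exists U, [/\ F U, U !=set0 & U `<=` closure W].
Proof.
move=> [UU UF clUU] [x /subset_closure]; rewrite -clUU => /(_ _ filterT).
case=> y [[U UUU Uy] _]; exists U; split; [exact: UF|by exists y|].
by move=> z Uz; apply: subset_closure; exists U.
Qed.

Lemma dense_eq_on (Y : topologicalType) (f g : X -> Y) W D :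
  hausdorff_space Y -> continuous f -> continuous g -> open W -> dense D ->
  (forall x, W x -> D x -> f x = g x) -> forall x, W x -> f x = g x.
Proof.
move=> hY cf cg oW dD fg x Wx; apply: contrapT => /eqP fgx.
move: hY; rewrite open_hausdorff => /(_ _ _ fgx)[[A B]/=].
rewrite !inE => -[Afx Bgx] [oA oB AB0].
have [||y [[Wy [Afy Bgy]] Dy]] := dD (W `&` (f @^-1` A `&` g @^-1` B)).
- by exists x.
- apply: openI => //; apply: openI; exact: open_comp.
suff : (A `&` B) (f y) by rewrite AB0.
by split; rewrite // fg.
Qed.

End Approximable.

(** * Compact Hausdorff spaces: from cozero-sets to clopen sets *)

Lemma piZD_cozero (R : realType) (K : topologicalType) :
  compact [set: K] -> hausdorff_space K ->
  (forall f : K -> R, continuous f -> approximable clopen [set x | f x <> 0]) ->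
  piZD K.
Proof.
move=> cK hK apK W oW [x Wx].
have [||||f [cf f0 f1 _]] := @urysohn_ext_itv _ R (compact_normal hK cK)
  (~` W) [set x] 0 1.
- exact: open_closedC.
- exact/accessible_closed_set1/hausdorff_accessible.
- by apply/seteqP; split => [y [Wy yx]|//]; apply: Wy;
    rewrite yx.
- exact: ltr01.
have fx : f x = 1 by apply: f1; exists x.
(* The cut at 1/2 keeps the closure of the cozero-set of [g] within [f >= 1/2], hence within [W];
   the cozero-set of [f] itself could have closure leaving [W]. *)
pose g y : R := Num.max (f y - 2^-1) 0.
have cg : continuous g.
  move=> y; apply: (@continuous_max _ _ (fun z => f z - 2^-1) (cst 0)).
    by apply: cvgB; [exact: cf|exact: cvg_cst].
  exact: cvg_cst.
have [|U [cU U0 UW]] := approximable_subclosure (apK g cg).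
  exists x; rewrite /= /g fx; apply/eqP; rewrite gt_eqF// lt_max.
  by rewrite subr_gt0 invf_lt1 ?ltr1n.
exists U; split => // y /UW cgy; apply: contrapT => Wy.
have fy : f y = 0 by apply: f0; exists y.
have [|z [/= gz fz]] := cgy [set z | f z < 2^-1].
  apply: open_nbhs_nbhs; split; last by rewrite /= fy invr_gt0.
  apply: (@open_comp _ _ f [set t | t < 2^-1]) => [? _|]; first exact: cf.
  exact: open_lt.
by apply: gz; apply/max_idPr; rewrite subr_le0 ltW.
Qed.

(** * Pointwise calculus in the Yosida representation *)

Lemma maxe_absE (R : realDomainType) (x : \bar R) : maxe x (- x)%E = `|x|%E.
Proof.
have [x0|x0] := leP 0%E x.
  by rewrite gee0_abs// max_l// (le_trans _ x0)// leeNl oppe0.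
by rewrite lte0_abs// max_r// (le_trans (ltW x0))// leeNr oppe0 ltW.
Qed.

Section YosidaRepresentation.
Variables (R : realType) (A : vectorLatticeType R) (u : A).
Variables (eta : A -> yosida u -> \bar R).
Hypothesis eta_rep : yosida_representation eta.
Implicit Types (a b c x y : A) (M : yosida u) (B C : set A)
  (E G U V W : set (yosida u)) (s : seq A).

Lemma yosida_ideal_sub M N : yosida_ideal M `<=` yosida_ideal N -> N = M.
Proof.
case: M N => I iI Iu maxI [J iJ Ju maxJ] /= IJ.
have JI : J = I by exact: maxI.
move: iJ Ju maxJ; rewrite JI => iI' Iu' maxI'.
by congr Yosida; exact: Prop_irrelevance.
Qed.

(** By maximality, the hull of the ideal [M] is the single point [M]. *)
Lemma yosida_closed1 M : closed [set M].
Proof.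
rewrite -[[set M]]setCK; apply: open_closedC; exists (yosida_ideal M).
congr (~` _); apply/seteqP; split => [_ ->//|N MN].
exact: yosida_ideal_sub.
Qed.

Lemma yosida_rep_continuous a : continuous (eta a).
Proof. by have [] := yosida_repD eta_rep a. Qed.

Lemma yosida_rep0 M : eta 0 M = 0%E.
Proof. by rewrite -(scale0r 0) (yosida_rep_scale eta_rep) mul0e. Qed.

Lemma yosida_repN a M : eta (- a) M = (- eta a M)%E.
Proof. by rewrite -scaleN1r (yosida_rep_scale eta_rep) mulN1e. Qed.

Lemma yosida_rep_add_fin a b M : eta a M \is a fin_num ->
  eta b M \is a fin_num -> eta (a + b) M = (eta a M + eta b M)%E.
Proof. by have [_] := yosida_rep_add eta_rep a b; apply. Qed.

Lemma yosida_rep_abs a M : eta (vabs a) M = `|eta a M|%E.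
Proof. by rewrite (yosida_rep_join eta_rep) yosida_repN maxe_absE. Qed.

(** Both sides say that the join of [a] and [b] is [b], since [eta] is injective and preserves
    joins. *)
Lemma yosida_rep_le a b : (forall M, (eta a M <= eta b M)%E) <-> a <= b.
Proof.
have jE : a <= b <-> vjoin a b = b.
  split=> [ab|<-]; last first.
    by have := lexx (vjoin a b); rewrite {1}vjoin_le => /andP[].
  apply: le_anti; rewrite vjoin_le ab lexx/=.
  by have := lexx (vjoin a b); rewrite {1}vjoin_le => /andP[].
rewrite jE; split => [ab|<- M].
  apply: (yosida_rep_inj eta_rep); apply/funext => M.
  by rewrite (yosida_rep_join eta_rep); apply/max_idPr.
by rewrite (yosida_rep_join eta_rep) le_max lexx.
Qed.

Definition fin_locus s : set (yosida u) :=
  [set M | all (fun c => eta c M \is a fin_num) s].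

Lemma open_fin_locus1 a : open [set M | eta a M \is a fin_num].
Proof.
apply: (@open_comp _ _ (eta a) [set r | r \is a fin_num]).
  by move=> ? _; exact: yosida_rep_continuous.
rewrite (_ : [set r | _] = [set r | (-oo < r)%E] `&` [set r | (r < +oo)%E]).
  by apply: openI; [exact: open_ereal_gt_ereal|exact: open_ereal_lt_ereal].
by apply/seteqP; split => r /=; rewrite fin_numElt => /andP.
Qed.

Lemma dense_fin_locus s : dense (fin_locus s).
Proof.
elim: s => [|a s IH].
  by move=> O [M OM] _; exists M.
rewrite (_ : fin_locus _ = [set M | eta a M \is a fin_num] `&` fin_locus s).
  apply: denseI => //; first exact: open_fin_locus1.
  by have [] := yosida_repD eta_rep a.
by apply/seteqP; split => M /andP.
Qed.

(* [eta (a + b)] is the pointwise sum only on the dense set of points where [a]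
   and [b] are finite; density and continuity make such points suffice. *)
Lemma yosida_rep_eq_on s W a b : open W ->
  (forall M, W M -> fin_locus s M -> eta a M = eta b M) ->
  forall M, W M -> eta a M = eta b M.
Proof.
move=> oW; apply: (dense_eq_on (@ereal_hausdorff R)) => //;
  [exact: yosida_rep_continuous|exact: yosida_rep_continuous|].
exact: dense_fin_locus.
Qed.

(** Density transfers equalities, so the inequality is recast as [b = vjoin a b]. *)
Lemma yosida_rep_le_fin s a b :
  (forall M, fin_locus s M -> (eta a M <= eta b M)%E) -> a <= b.
Proof.
move=> ab; apply/yosida_rep_le => M.
have -> : eta b M = eta (vjoin a b) M.
  apply: (@yosida_rep_eq_on s setT) => //; first exact: openT.
  by move=> N _ /ab; rewrite (yosida_rep_join eta_rep) => /max_idPr.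
by rewrite (yosida_rep_join eta_rep) le_max lexx.
Qed.

(** A Urysohn lemma inside [A]: 0-1 separation of the point from the complement of [W], made
    nonnegative by [vabs]. *)
Lemma yosida_point_separation W M : open W -> W M ->
  exists a, [/\ 0 <= a, eta a M = 1%E & forall N, ~ W N -> eta a N = 0%E].
Proof.
move=> oW WM.
have [|a [a0 a1]] := yosida_rep_separates eta_rep (open_closedC oW)
  (@yosida_closed1 M).
  by apply/seteqP; split => [N [WN NM]|//]; apply: WN; rewrite NM.
exists (vabs a); split; first exact: vabs_ge0.
  by rewrite yosida_rep_abs a1// abse1.
by move=> N WN; rewrite yosida_rep_abs a0// abse0.
Qed.

(** * Bands of vanishing elements and projection bands *)

Definition vanishing_on G : set A := [set a | forall M, G M -> eta a M = 0%E].

(** For suprema: if [s] were nonzero at a point of [G], subtracting from [s] a small bump supported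
    in [G] would give a smaller upper bound. *)
Lemma band_vanishing_on G : open G -> band (vanishing_on G).
Proof.
move=> oG; split; [split|].
- by move=> M _; exact: yosida_rep0.
- by move=> a b aG bG M GM; rewrite yosida_rep_add_fin ?aG ?bG ?adde0.
- by move=> r a aG M GM; rewrite (yosida_rep_scale eta_rep) aG// mule0.
- move=> a b /yosida_rep_le ab bG M GM; apply/eqP; rewrite -abse_eq0.
  have := ab M; rewrite !yosida_rep_abs bG// abse0 => h.
  by apply/eqP/le_anti; rewrite h abse_ge0.
move=> S s SG [sub slub] M GM; apply/eqP; apply: contraT => sM.
have [S0|] := pselect (S !=set0); last first.
  (* Every element bounds the empty set above, so [s - u] would too, although it lies strictly below
     [s]. *)
  move=> /nonemptyPn S0.
  have : s <= s - u by apply: slub => x; rewrite S0.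
  move=> /(vlat_leD2r (- s)); rewrite subrr addrAC subrr add0r.
  move=> /yosida_rep_le/(_ M); rewrite yosida_rep0 yosida_repN.
  by rewrite (yosida_rep_unit eta_rep)/= lee_fin oppr_ge0 ler10.
have s0 N : G N -> (0 <= eta s N)%E.
  have [b Sb] := S0; move=> GN; rewrite -(SG b Sb N GN).
  by move: N {GN}; apply/yosida_rep_le/sub.
have [c [c0 cM cG]] := yosida_point_separation oG GM.
(* The bump: at most [s] on [G], zero off [G], nonzero at [M]. *)
pose d := vmeet c (vabs s).
have dE N : eta d N = Order.min (eta c N) `|eta s N|%E.
  by rewrite (yosida_rep_meet eta_rep) yosida_rep_abs.
have : s <= s - d.
  apply: slub => b Sb; apply: (@yosida_rep_le_fin [:: s; d]) => N.
  move=> /and3P[sN dN _]; rewrite yosida_rep_add_fin ?yosida_repN ?fin_numN//.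
  have [GN|GN] := pselect (G N).
    rewrite (SG b Sb)// sube_ge0 ?dN//.
    by rewrite dE ge_min orbC gee0_abs ?s0// lexx.
  rewrite dE cG// min_l ?abse_ge0// sube0.
  by move: N {sN dN GN}; apply/yosida_rep_le/sub.
move=> /(vlat_leD2r (- s)); rewrite subrr addrAC subrr add0r.
move=> /yosida_rep_le/(_ M); rewrite yosida_rep0 yosida_repN oppe_ge0 dE cM.
by rewrite ge_min lee_fin ler10/= leNgt lt0e abse_ge0 abse_eq0 sM.
Qed.

(* Write [u = p + q] along the direct sum: disjointness forces [p] and [q] to
    take only the values 0 and 1, so the support of [p] is clopen. *)
Lemma projection_band_clopen C : projection_band C ->
  exists2 U, yosida_lambda eta U & C = vanishing_on (~` U).
Proof.
move=> [[iC _]] [C' [iC' _] [CC' CC'0]].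
have disj a b M : C a -> C' b -> eta a M = 0%E \/ eta b M = 0%E.
  move=> Ca C'b.
  have m0 : 0 <= vmeet (vabs a) (vabs b) by exact: vmeet_vabs_ge0.
  have [ma mb] : vmeet (vabs a) (vabs b) <= vabs a /\
                 vmeet (vabs a) (vabs b) <= vabs b.
    by apply/andP; rewrite -le_vmeet.
  (* The meet lies in both ideals by solidity, hence is 0. *)
  have : (C `&` C') (vmeet (vabs a) (vabs b)).
    by split; [apply: (vlattice_ideal_solid iC _ Ca)
              |apply: (vlattice_ideal_solid iC' _ C'b)]; rewrite ge0_vabs.
  rewrite CC'0 => /(congr1 (eta^~ M)); rewrite yosida_rep0.
  rewrite (yosida_rep_meet eta_rep) !yosida_rep_abs.
  by case: leP => _ /eqP; rewrite abse_eq0 => /eqP; [left|right].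
have [p [q [Cp C'q upq]]] := CC' u.
have osupp a : open [set M | eta a M != 0%E].
  apply: (@open_comp _ _ (eta a) [set r | r != 0%E]).
    by move=> ? _; exact: yosida_rep_continuous.
  rewrite (_ : [set r | _] = ~` [set 0%E]).
    exact/closed_openC/accessible_closed_set1/hausdorff_accessible/ereal_hausdorff.
  by apply/seteqP; split => r /= /eqP.
have supp1 a b M : u = a + b -> (forall N, eta a N = 0%E \/ eta b N = 0%E) ->
    eta a M != 0%E -> eta a M = 1%E.
  move=> uab ab0 aM; rewrite -[RHS]/(cst 1%E M) -(yosida_rep_unit eta_rep).
  apply: (@yosida_rep_eq_on [:: a; b] _ _ _ (osupp a)) aM => N /eqP aN.
  move=> /and3P[aF bF _]; rewrite uab yosida_rep_add_fin//.
  by have [//|->] := ab0 N; rewrite adde0.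
have p1 M : eta p M != 0%E -> eta p M = 1%E.
  by apply: (supp1 p q) => // N; exact: disj.
have q1 M : eta q M != 0%E -> eta q M = 1%E.
  by apply: (supp1 q p) => [|N]; [rewrite addrC|apply/or_comm/disj].
have fin01 a M : (eta a M != 0%E -> eta a M = 1%E) -> eta a M \is a fin_num.
  by have [->//|_ /(_ isT)->] := eqVneq (eta a M) 0%E.
have pq M : (eta p M + eta q M)%E = 1%E.
  rewrite -yosida_rep_add_fin; [|exact/fin01/p1|exact/fin01/q1].
  by rewrite -upq (yosida_rep_unit eta_rep).
pose U := [set M | eta p M != 0%E].
(* As [p + q = 1] with one summand zero at each point, the two open supports are complementary. *)
have UqE : ~` U = [set M | eta q M != 0%E].
  apply/seteqP; split => M /=; rewrite /U/=.
    by move=> /negP/negPn/eqP pM; have := pq M; rewrite pM add0e => ->;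
      rewrite onee_neq0.
  by move=> qM pM; have [/eqP|/eqP] := disj _ _ M Cp C'q; apply/negP.
have CU b : C b -> vanishing_on (~` U) b.
  move=> Cb M; rewrite UqE => qM; have [//|/eqP] := disj _ _ M Cb C'q.
  by rewrite (negbTE qM).
have C'U b : C' b -> vanishing_on U b.
  by move=> Cb M pM; have [/eqP|//] := disj _ _ M Cp Cb; rewrite (negbTE pM).
(* The [C]-component of [a] is its restriction to [U]; this gives both [yosida_lambda eta U] and the
   description of [C]. *)
have etaU a b c : a = b + c -> C b -> C' c -> eta b = patch (cst 0%E) U (eta a).
  move=> abc Cb C'c; apply/funext => M; rewrite /patch; case: ifPn; last first.
    by rewrite notin_setE => UM; exact: CU.
  rewrite inE; apply: (@yosida_rep_eq_on [:: b; c]); first exact: osupp.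
  move=> N UN /and3P[bN cN _].
  by rewrite abc yosida_rep_add_fin// [eta c N]C'U// adde0.
exists U.
  split.
    by split; [exact: osupp|rewrite -[U]setCK UqE; exact/open_closedC/osupp].
  by move=> a; have [b [c [Cb C'c abc]]] := CC' a; exists b => //;
    exact: (etaU a b c).
apply/seteqP; split => [b|a aU]; first exact: CU.
have [b [c [Cb C'c abc]]] := CC' a.
suff -> : a = b by [].
apply: (yosida_rep_inj eta_rep); rewrite (etaU a b c)//; apply/funext => M.
by rewrite /patch; case: ifPn => //; rewrite notin_setE => /aU ->.
Qed.

(** The complementary band is [vanishing_on U]: each [a] splits into its restriction to [U] and the
    remainder. *)
Lemma projection_band_vanishing_on U : yosida_lambda eta U ->
  projection_band (vanishing_on (~` U)).
Proof.
move=> [[oU cU] Up]; split.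
  exact/band_vanishing_on/closed_openC.
exists (vanishing_on U); first exact: band_vanishing_on.
split=> [a|].
  have [b _ bE] := Up a; exists b, (a - b); split; last by rewrite addrC subrK.
    by move=> M UM; rewrite bE /patch; case: ifPn => //; rewrite inE.
  move=> M; rewrite -(yosida_rep0 M); apply: (@yosida_rep_eq_on [:: a; b]) => //.
  move=> N UN /and3P[aN bN _]; rewrite yosida_rep_add_fin ?yosida_repN ?fin_numN//.
  by rewrite bE /patch mem_set// subee// yosida_rep0.
apply/seteqP; split => [a [aU' aU]|_ ->]; last by split=> M _; exact: yosida_rep0.
apply: (yosida_rep_inj eta_rep); apply/funext => M; rewrite yosida_rep0.
by have [/aU|/aU'] := pselect (U M).
Qed.

(* [|x|] is the supremum of the elements [|x|] meet [n|b|] of [B]. *)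
Lemma band_vanishing_sub B b U (e : R) : band B -> B b -> 0 < e ->
  (forall M, U M -> (e%:E <= `|eta b M|)%E) -> vanishing_on (~` U) `<=` B.
Proof.
move=> [iB supB] Bb e0 eU x xU.
suff Bx : B (vabs x).
  by apply: (vlattice_ideal_solid iB) Bx; rewrite (ge0_vabs (vabs_ge0 _)).
pose S := [set vmeet (vabs x) (vabs b *+ n) | n in @setT nat].
have b0 n : 0 <= vabs b *+ n.
  elim: n => [|n IH]; first by rewrite mulr0n lexx.
  by rewrite mulrS -[0]addr0 vlat_leD ?vabs_ge0.
apply: (supB S).
  move=> _ [n _ <-].
  have := lexx (vmeet (vabs x) (vabs b *+ n)).
  rewrite {1}le_vmeet => /andP[_ mb].
  apply: (vlattice_ideal_solid iB (b := vabs b *+ n)).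
    by rewrite [leLHS]ge0_vabs ?[leRHS]ge0_vabs// le_vmeet vabs_ge0 b0.
  by rewrite -scaler_nat; apply: vlattice_idealZ => //; exact: ideal_vabs.
split=> [_ [n _ <-]|y yS].
  have := lexx (vmeet (vabs x) (vabs b *+ n)).
  by rewrite {1}le_vmeet => /andP[].
apply: (@yosida_rep_le_fin [:: x]) => M /andP[xM _].
have ySM n : (Order.min `|eta x M| (n%:R%:E * `|eta b M|) <= eta y M)%E.
  have /yS/yosida_rep_le/(_ M) : S (vmeet (vabs x) (vabs b *+ n)) by exists n.
  rewrite (yosida_rep_meet eta_rep) -scaler_nat (yosida_rep_scale eta_rep).
  by rewrite !yosida_rep_abs.
rewrite yosida_rep_abs.
have [UM|UM] := pselect (U M); last first.
  by have := ySM 0%N; rewrite xU// abse0 mul0e minxx.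
(* At a point where [x] is finite, some [n * e], hence [n|b|], exceeds [|x|], and the meet there is
   [|x|] itself. *)
have [n xn] : exists n : nat, (`|eta x M| <= n%:R%:E * e%:E)%E.
  exists (Num.bound (fine `|eta x M| / e)).
  rewrite -[leLHS]fineK ?abse_fin_num// -EFinM lee_fin -ler_pdivrMr//.
  rewrite ltW// archi_boundP// divr_ge0 ?fine_ge0 ?abse_ge0//.
  exact: ltW.
rewrite (le_trans _ (ySM n))// le_min lexx/= (le_trans xn)//.
by apply: lee_wpmul2l; [rewrite lee_fin ler0n|exact: eU].
Qed.

(** * SMP and approximation by members of [yosida_lambda eta] *)

Lemma SMP_approximable : SMP A ->
  forall W, open W -> approximable (yosida_lambda eta) W.
Proof.
move=> smp; apply: pi_base_approximable => W oW [M WM].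
have [a [a0 aM aW]] := yosida_point_separation oW WM.
pose V := [set N | ((2^-1 : R)%:E < eta a N)%E].
have oV : open V.
  apply: (@open_comp _ _ (eta a) [set r | ((2^-1)%:E < r)%E]).
    by move=> ? _; exact: yosida_rep_continuous.
  exact: open_ereal_gt_ereal.
(* An open set containing the closed complement of [W], so that vanishing on it defines a band. *)
pose V' := [set N | (eta a N < (2^-1 : R)%:E)%E].
have oV' : open V'.
  apply: (@open_comp _ _ (eta a) [set r | (r < (2^-1)%:E)%E]).
    by move=> ? _; exact: yosida_rep_continuous.
  exact: open_ereal_lt_ereal.
have VM : V M by rewrite /V/= aM lte_fin invf_lt1 ?ltr1n.
have [c [c0 cM cV]] := yosida_point_separation oV VM.
(* A bump at [M] inside [V], witnessing that the band is nonzero. *)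
have Bc : vanishing_on V' c.
  by move=> N V'N; apply: cV => /(lt_trans V'N); rewrite ltxx.
have [|C [pC C0 CB]] := smp _ (band_vanishing_on oV').
  move=> B0; move: Bc; rewrite B0 => c00; move: cM; rewrite c00 yosida_rep0.
  by move=> /esym/eqP; rewrite onee_eq0.
have [U lU CU] := projection_band_clopen pC.
exists U; split => //.
  apply/set0P/eqP => U0; apply: C0; rewrite CU U0 setC0.
  apply/seteqP; split => [x x0|_ ->]; last by move=> N _; exact: yosida_rep0.
  by apply: (yosida_rep_inj eta_rep); apply/funext => N; rewrite x0// yosida_rep0.
(* [p] is the characteristic function of [U]; it vanishes on [V'], so [U] misses the complement of
   [W]. *)
have [[_ cU] Up] := lU; have [p _ pE] := Up u.
have : vanishing_on V' p.
  by apply: CB; rewrite CU => N UN; rewrite pE /patch; case: ifPn => //; rewrite inE.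
move=> pV' N UN; apply: contrapT => WN.
have : eta p N = 0%E by apply: pV'; rewrite /V'/= aW// lte_fin invr_gt0.
rewrite pE /patch mem_set// (yosida_rep_unit eta_rep) => /eqP.
by rewrite onee_eq0.
Qed.

Lemma approximable_SMP :
  (forall a, approximable (yosida_lambda eta) [set M | eta a M <> 0%E]) ->
  SMP A.
Proof.
move=> apA B bB B0; have [iB _] := bB.
have [b Bb b0] : exists2 b, B b & b <> 0.
  apply: contrapT => h; apply: B0.
  apply/seteqP; split => [b Bb|_ ->]; last first.
    exact: vlattice_ideal0.
  by apply: contrapT => b0; apply: h; exists b.
have [M bM bF] : exists2 M, eta b M != 0%E & eta b M \is a fin_num.
  apply: contrapT => h; apply: b0; apply: (yosida_rep_inj eta_rep).
  apply/funext => M.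
  apply: (@yosida_rep_eq_on [:: b] setT) => //; first exact: openT.
  move=> N _ /andP[bN _]; rewrite yosida_rep0; apply/eqP; apply: contraT => bN0.
  by exfalso; apply: h; exists N.
pose e := fine `|eta b M|%E / 2.
have b_gt0 : 0 < fine `|eta b M|%E.
  by rewrite fine_gt0// -ge0_fin_numE// abse_fin_num bF lt0e abse_eq0 bM abse_ge0.
have e0 : 0 < e by rewrite divr_gt0.
(* The positive part of [|b| - e]: nonzero at [M], since [e] is half of [|b|] there, and with
   cozero-set whose closure stays in [|b| >= e]. *)
pose a := vjoin (vabs b - e *: u) 0.
have euE N : eta (- (e *: u)) N = (- e)%:E.
  by rewrite yosida_repN (yosida_rep_scale eta_rep) (yosida_rep_unit eta_rep) mule1.
have aE N : eta b N \is a fin_num -> eta a N = Order.max (`|eta b N| - e%:E)%E 0%E.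
  move=> bN; rewrite (yosida_rep_join eta_rep) yosida_rep0 yosida_rep_add_fin.
  - by rewrite euE yosida_rep_abs.
  - by rewrite yosida_rep_abs abse_fin_num.
  - by rewrite euE.
have [|U [lU U0 Ua]] := approximable_subclosure (apA a).
  exists M; rewrite /= aE//; apply/eqP; rewrite gt_eqF// lt_max.
  rewrite sube_gt0 -[ltRHS]fineK ?abse_fin_num// lte_fin.
  by rewrite /e ltr_pdivrMr// ltr_pMr// ltr1n.
have eU N : U N -> (e%:E <= `|eta b N|)%E.
  move=> /Ua cN; rewrite leNgt; apply/negP => bN.
  have oW : open [set N | (`|eta b N| < e%:E)%E].
    under eq_fun do rewrite -yosida_rep_abs.
    apply: (@open_comp _ _ (eta (vabs b)) [set r | (r < e%:E)%E]).
      by move=> ? _; exact: yosida_rep_continuous.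
    exact: open_ereal_lt_ereal.
  have [N' [/= aN' bN']] := cN _ (open_nbhs_nbhs (conj oW bN)).
  apply: aN'; rewrite aE; first by apply/max_idPr; rewrite sube_le0 ltW.
  by rewrite -abse_fin_num ge0_fin_numE// (lt_trans bN') ?ltry.
exists (vanishing_on (~` U)); split.
- exact: projection_band_vanishing_on.
(* The characteristic function of [U] is a nonzero element of the band. *)
- have [_ Up] := lU; have [p _ pE] := Up u; have [N UN] := U0.
  move=> C0; have : vanishing_on (~` U) p.
    by move=> N' UN'; rewrite pE /patch; case: ifPn => //; rewrite inE.
  rewrite C0 => p0; have := congr1 (@^~ N) pE.
  rewrite p0 yosida_rep0 /patch mem_set// (yosida_rep_unit eta_rep) => /esym/eqP.
  by rewrite onee_eq0.
- exact: band_vanishing_sub eU.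
Qed.

End YosidaRepresentation.

Theorem theorem3p1 (R : realType) :
  (forall K : topologicalType, compact [set: K] -> hausdorff_space K ->
    [<-> piZD K;
         forall W : set K, open W -> approximable clopen W;
         forall f : K -> R, continuous f ->
           approximable clopen [set x | f x <> 0]]) /\
  (forall (A : vectorLatticeType R) (u : A)
      (eta : A -> yosida u -> \bar R),
    archimedean_vlattice A -> weak_order_unit u ->
    yosida_representation eta ->
    [<-> SMP A;
         forall W : set (yosida u), open W -> approximable (yosida_lambda eta) W;
         forall a : A, approximable (yosida_lambda eta) [set M | eta a M <> 0%E]]).
Proof.
split=> [K cK hK|A u eta _ _ eta_rep]; tfae.
- by move=> K_piZD; exact: pi_base_approximable.
- move=> apK f cf; apply: apK.
  apply: (@open_comp _ _ f [set r | r <> 0]) => [? _|]; first exact: cf.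
  exact/closed_openC/closed_eq.
- exact: piZD_cozero.
- exact: SMP_approximable.
- move=> apA a; apply: apA.
  apply: (@open_comp _ _ (eta a) [set r | r <> 0%E]) => [? _|].
    exact: yosida_rep_continuous.
  exact/closed_openC/accessible_closed_set1/hausdorff_accessible/ereal_hausdorff.
- exact: approximable_SMP.
Qed.
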